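(* Let $X$ be a separable infinite-dimensional Banach space and let $T$ be a bounded linear operator on $X$. Then: (1) $T$ is $\mathcal{U}$-frequently hypercyclic if and only if $T$ is $\mathcal{U}$-frequently hypercyclic with respect to each $a\in\mathcal{S}$. (2) $T$ is reiteratively hypercyclic if and only if $T$ is $\mathcal{U}$-frequently hypercyclic with respect to some $a\in\mathcal{S}$. Moreover, $$UFHC(T)=\bigcap_{a\in\mathcal{S}}UFHC_a(T)\quad\text{and}\quad RHC(T)=\bigcup_{a\in\mathcal{S}}UFHC_a(T).$$
   Context: $\mathbb{N}=\{0,1,2,\dots\}$. For a non-decreasing sequence $a=(a_n)_{n\in\mathbb{N}}$ of non-negative real numbers put $v_n(a)=\dfrac{a_n}{\sum_{j=0}^{n-1}a_j}$, considered only for those $n$ with $\sum_{j=0}^{n-1}a_j>0$. The class $\mathcal{S}$ is the set of all sequences $a=(a_n)_{n\in\mathbb{N}}$ of non-negative reals such that $(a_n)$ is non-decreasing, $a_n\to+\infty$, $(v_n(a))$ is non-increasing and $v_n(a)\to 0$. For $A\subseteq\mathbb{N}$: the upper density is $\overline{d}(A)=\limsup_{N\to+\infty}\frac{\#([0,N]\cap A)}{N+1}$; for $a\in\mathcal{S}$ the upper $a$-density is $\overline{d}_a(A)=\limsup_{N\to+\infty}\frac{\sum_{j=0}^{N}a_j\mathbf{1}_A(j)}{\sum_{j=0}^{N}a_j}$, where $\mathbf 1_A$ is the indicator function of $A$; the upper Banach density is $\overline{Bd}(A)=\lim_{N\to+\infty}\frac{b_N}{N}$ where $b_N=\limsup_{k\to+\infty}\#(A\cap[k+1,k+N])$.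 For $x\in X$ and $U\subseteq X$, let $N(x,U)=\{n\in\mathbb{N}: T^nx\in U\}$. Let $UFHC(T)$ (resp. $UFHC_a(T)$, resp. $RHC(T)$) be the set of $x\in X$ such that $\overline{d}(N(x,U))>0$ (resp. $\overline{d}_a(N(x,U))>0$, resp. $\overline{Bd}(N(x,U))>0$) for every non-empty open set $U\subseteq X$. The operator $T$ is called $\mathcal{U}$-frequently hypercyclic (resp. $\mathcal{U}$-frequently hypercyclic with respect to $a$, resp. reiteratively hypercyclic) if the corresponding set is non-empty. *)

(* Defs.v *)
From mathcomp Require Import all_boot all_order all_algebra finmap.
From mathcomp Require Import all_classical all_reals all_analysis.
From mathcomp Require Import complex.

Set Implicit Arguments.
Unset Strict Implicit.
Unset Printing Implicit Defensive.

Import Order.TTheory GRing.Theory Num.Theory.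
Import numFieldNormedType.Exports.

Local Open Scope classical_set_scope.
Local Open Scope ring_scope.

Inductive real_or_complex (R : realType) : numFieldType -> Prop :=
| real_scalars : real_or_complex R R
| complex_scalars : real_or_complex R (R[i]).

Definition separable (X : topologicalType) : Prop :=
  exists2 D : set X, countable D & dense D.

Definition finite_dimensional (K : numFieldType) (X : lmodType K) : Prop :=
  exists (n : nat) (e : 'I_n -> X),
    forall x, exists c : 'I_n -> K, x = \sum_(i < n) c i *: e i.

Definition infinite_dimensional (K : numFieldType) (X : lmodType K) : Prop :=
  ~ finite_dimensional X.

Definition bounded_operator (K : numFieldType) (X : normedModType K)
    (T : {linear X -> X}) : Prop :=
  exists M : K, forall x, `|T x| <= M * `|x|.

Section densities.
Context {R : realType}.
Implicit Types (a : R^nat) (A : set nat).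

(** Only meaningful when the denominator is positive; the junk value at the
    other indices never matters below. *)
Definition v a (n : nat) : R := a n / \sum_(0 <= j < n) a j.

(** As [a] tends to [+oo], only finitely many [v a n] have a zero denominator,
    so these do not affect the limit of [v a]. *)
Definition classS : set R^nat := [set a |
  [/\ forall n, 0 <= a n,
      nondecreasing_seq a,
      a @ \oo --> +oo,
      forall m n, (m <= n)%N ->
        0 < \sum_(0 <= j < m) a j -> 0 < \sum_(0 <= j < n) a j ->
        v a n <= v a m
    & v a @ \oo --> (0 : R)]].

Definition card_between A (m n : nat) : nat :=
  #|` fset_set (A `&` [set j | (m <= j <= n)%N])|%fset.

Definition upper_density A : \bar R :=
  limn_esup (fun N => ((card_between A 0 N)%:R / N.+1%:R)%:E).

Definition upper_weighted_density a A : \bar R :=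
  limn_esup (fun N =>
    ((\sum_(0 <= j < N.+1) a j * \1_A j) / \sum_(0 <= j < N.+1) a j)%:E).

Definition banach_count A (N : nat) : \bar R :=
  limn_esup (fun k => (card_between A (k + 1) (k + N))%:R%:E).

Definition upper_banach_density A : \bar R :=
  limn (fun N => banach_count A N * (N%:R^-1)%:E)%E.

End densities.

Section hypercyclicity.
Context (R : realType) {X : topologicalType}.
Implicit Types (T : X -> X) (x : X) (U : set X) (a : R^nat).

Definition return_set T x U : set nat := [set n | U (iter n T x)].

Definition UFHC T : set X := [set x | forall U, open U -> U !=set0 ->
  (0 < @upper_density R (return_set T x U))%E].

Definition UFHC_wrt a T : set X := [set x | forall U, open U -> U !=set0 ->
  (0 < upper_weighted_density a (return_set T x U))%E].

Definition RHC T : set X := [set x | forall U, open U -> U !=set0 ->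
  (0 < @upper_banach_density R (return_set T x U))%E].

Definition U_frequently_hypercyclic T : Prop := UFHC T !=set0.

Definition U_frequently_hypercyclic_wrt a T : Prop := UFHC_wrt a T !=set0.

Definition reiteratively_hypercyclic T : Prop := RHC T !=set0.

End hypercyclicity.

Arguments UFHC_wrt {R X} a T.
Arguments U_frequently_hypercyclic_wrt {R X} a T.

(* Main.v *)
Require Import Defs.
From mathcomp Require Import all_boot all_order all_algebra.
From mathcomp Require Import all_classical all_reals all_analysis.
From mathcomp Require Import finmap complex zify ring lra.
Import Order.TTheory GRing.Theory Num.Theory.
Import numFieldNormedType.Exports.

Set Implicit Arguments.
Unset Strict Implicit.
Unset Printing Implicit Defensive.

Local Open Scope classical_set_scope.
Local Open Scope ring_scope.

(** Each of the three notions only asks that certain return sets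
    [A = N(x, U)] have positive density, so the theorem reduces to comparing
    densities of subsets of [nat]. Three comparisons hold for a fixed set [A].

    - If [A] has positive upper density then it has positive upper [a]-density
      for every [a] in the class: a bound
      [sum_(j < n) a_j 1_A(j) <= e * sum_(j < n) a_j] valid from some point on
      turns, after an Abel summation against the non-increasing sequence
      [1 / a_j], into [#(A cap [0, n)) <= e * n + O(1)]
      ([upper_density_gt0_weighted]).
    - For the weights [a_n = n + 1] the converse implication holds, because
      these weights are at most about twice their average
      ([weighted_succ_gt0_upper_density]). Hence the intersection formula.
    - If [A] has positive upper [a]-density for some [a] in the class then its
      upper Banach density is positive: the condition [v_n(a) -> 0] makes [a]
      almost constant on late windows of a fixed length, so that [A] cannot be
      sparse in all of them ([weighted_gt0_upper_banach]).

    What remains is to find, for [x] in [RHC T], one sequence [a] serving all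
    open sets [U] at once. As [X] has a countable pi-base, it is enough to serve
    countably many sets [A_i] of positive upper Banach density
    ([exists_classS_weighted_gt0]). Every [A_i] meets arbitrarily late windows
    of every length [N] in at least [c_i * N] points; this uses that the limit
    defining the Banach density is an infimum ([upper_banach_density_gt0P]).
    Let [w] be a slowly growing step function that increases by one at each
    jump, and let [a] be the solution of [v_n(a) = 1 / w_n]. Then [a_(n+1) / a_n]
    is [1 + 1 / w_n] inside a step and exactly [1] at a jump, so [a] is
    non-decreasing. On a window of length [N] lying in the step [w = N], the
    partial sums of [a] are multiplied by [(1 + 1/N)^N], which lies between [2]
    and [e]: the window carries a positive proportion of the total weight,
    almost uniformly spread ([step_weight_window]). Placing at the end of the
    step [w = N] a window of length [N] rich in points of [A_i], where every [i]
    is used for infinitely many [N], gives all [A_i] positive upper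
    [a]-density. *)

(** * Limits superior *)

Definition frequently (P : nat -> Prop) := forall M, exists2 n, (M <= n)%N & P n.

Lemma frequentlyS (P Q : nat -> Prop) :
  (forall n, P n -> Q n) -> frequently P -> frequently Q.
Proof. by move=> PQ fP M; have [n Mn /PQ ?] := fP M; exists n. Qed.

Lemma not_frequently (P : nat -> Prop) :
  ~ frequently P -> exists M, forall n, (M <= n)%N -> ~ P n.
Proof.
move=> nfP; apply: contrapT => nM; apply: nfP => M.
apply: contrapT => nP; apply: nM; exists M => n Mn Pn.
by apply: nP; exists n.
Qed.

Section Limsup.
Context {R : realType}.
Implicit Types (u : R^nat) (c : R).

Lemma limn_esup_gt_frequently u c :
  (c%:E < limn_esup (fun n => (u n)%:E))%E -> frequently (fun n => c < u n).
Proof.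
move=> cu M; apply: contrapT => nM; move: cu; apply/negP; rewrite -leNgt.
rewrite /limn_esup limf_esupE; apply: ereal_inf_le.
exists (ereal_sup [set (u n)%:E | n in [set n | (M <= n)%N]]).
  by exists [set n | (M <= n)%N] => //; exists M.
apply: ge_ereal_sup => _ [n /= Mn <-]; rewrite lee_fin leNgt.
by apply/negP => cun; apply: nM; exists n.
Qed.

Lemma frequently_le_limn_esup u c :
  frequently (fun n => c <= u n) -> (c%:E <= limn_esup (fun n => (u n)%:E))%E.
Proof.
move=> fu; rewrite /limn_esup limf_esupE; apply: le_ereal_inf_tmp.
move=> _ [V [M _ MV] <-]; have [n Mn cun] := fu M.
apply: (@le_trans _ _ (u n)%:E); first by rewrite lee_fin.
by apply: ereal_sup_ubound; exists n => //; apply: MV.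
Qed.

Lemma limn_esup_gt0P u : (0 < limn_esup (fun n => (u n)%:E))%E <->
  exists2 c, 0 < c & frequently (fun n => c <= u n).
Proof.
split=> [u0|[c c0 /frequently_le_limn_esup]]; last first.
  by apply: lt_le_trans; rewrite lte_fin.
have [c c0 cu] : exists2 c, 0 < c & (c%:E < limn_esup (fun n => (u n)%:E))%E.
  move: u0; case: (limn_esup _) => [r| |] //.
    by rewrite lte_fin => r0; exists (r / 2); rewrite ?lte_fin; lra.
  by exists 1 => //; rewrite ltry.
exists c => //; apply: frequentlyS (limn_esup_gt_frequently cu) => n.
exact: ltW.
Qed.

(** Integers leave no room below a limit value, so the limsup is the largest
    value taken infinitely often. *)
Lemma limn_esup_nat (f : nat -> nat) (m : nat) :
    frequently (fun n => (m <= f n)%N) -> ~ frequently (fun n => (m < f n)%N) ->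
  limn_esup (fun n => ((f n)%:R : R)%:E) = m%:R%:E.
Proof.
move=> fm nfm; apply/eqP; rewrite eq_le; apply/andP; split; last first.
  by apply: frequently_le_limn_esup; apply: frequentlyS fm => n; rewrite ler_nat.
rewrite leNgt; apply/negP => /limn_esup_gt_frequently fm'.
by apply: nfm; apply: frequentlyS fm' => n; rewrite ltr_nat.
Qed.

End Limsup.

(** * Counting points in windows *)

Section Counting.
Implicit Types (A : set nat) (m n k N : nat).

Lemma card_betweenE A m n :
  card_between A m n = (\sum_(m <= j < n.+1) (j \in A))%N.
Proof.
rewrite /card_between; set S := _ `&` _.
have finS : finite_set S.
  apply: (@sub_finite_set _ _ `I_n.+1) => [j [_ /= /andP[_ jn]] //|].
  exact: finite_II.
rewrite -big_mkcond /= sum1_count -size_filter; apply: perm_size.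
apply: uniq_perm; first exact: fset_uniq.
  by rewrite filter_uniq // iota_uniq.
move=> j; rewrite mem_filter mem_index_iota ltnS.
have -> : (j \in finmap.enum_fset (fset_set S)) = (j \in S).
  by rewrite -(in_fset_set finS).
by apply/idP/idP => [/set_mem [? ?]|/andP[/set_mem ? ?]];
  [apply/andP; split => //; exact/mem_set|apply: mem_set; split].
Qed.

Lemma card_between_le A k N : (card_between A (k + 1) (k + N) <= N)%N.
Proof.
rewrite card_betweenE -[leqRHS](_ : (\sum_(k + 1 <= j < (k + N).+1) 1 = N)%N).
  by apply: leq_sum => j _; case: (j \in A).
by rewrite sum_nat_const_nat; lia.
Qed.

Lemma card_between_cat A k M N : card_between A (k + 1) (k + (M + N)) =
  (card_between A (k + 1) (k + M) + card_between A (k + M + 1) (k + M + N))%N.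
Proof.
by rewrite !card_betweenE addnA -[(k + M).+1]addn1
  (@big_cat_nat _ _ _ (k + M + 1)%N) //=; lia.
Qed.

Lemma card_betweenR (R : realType) A m n :
  (card_between A m n)%:R = \sum_(m <= j < n.+1) \1_A j :> R.
Proof.
by rewrite card_betweenE natr_sum; apply: eq_bigr => j _; rewrite indicE.
Qed.

End Counting.

(** * Upper Banach density and subadditivity *)

(** Fekete's subadditive lemma: with [n = q * m + r] the value [b n] is at most
    [q * b m] up to an error bounded in terms of [m], so [b n / n] comes close to
    its infimum. *)
Lemma fekete (R : realType) (b : R^nat) : (forall n, 0 <= b n) ->
    (forall m n, b (m + n)%N <= b m + b n) ->
  exists2 L : R, b n * n%:R^-1 @[n --> \oo] --> L & forall n, L * n%:R <= b n.
Proof.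
move=> b0 bD.
pose S := [set b n.+1 / n.+1%:R | n in [set: nat]].
have S0 : has_inf S.
  split; first by exists (b 1%N / 1%:R), 0%N.
  by exists 0 => _ [n _ <-]; rewrite divr_ge0.
have LS n : inf S * n%:R <= b n.
  case: n => [|n]; first by rewrite mulr0.
  rewrite -ler_pdivlMr ?ltr0n//; apply: ge_inf; first by case: S0.
  by exists n.
exists (inf S) => //.
have b_lin n : b n <= b 0%N + n%:R * b 1%N.
  elim: n => [|n IH]; first by rewrite mul0r addr0.
  rewrite -addn1; apply: le_trans (bD _ _) _.
  by rewrite natrD mulrDl mul1r addrA lerD2r.
have b_mul m q r : b (q * m + r)%N <= q%:R * b m + b r.
  elim: q => [|q IH]; first by rewrite mul0n mul0r add0n add0r.
  rewrite mulSn -addnA; apply: le_trans (bD _ _) _.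
  by rewrite -[q.+1]add1n natrD mulrDl mul1r -addrA lerD2l.
apply/cvgrPdist_le => e e0.
have [_ [m _ <-] bm] : exists2 x, S x & x < inf S + e / 2.
  by apply: inf_adherent => //; lra.
pose C := b 0%N + m.+1%:R * b 1%N.
have C0 : 0 <= C by rewrite addr_ge0 ?mulr_ge0.
near=> n.
have n0 : (0 < n)%N by near: n; exact: nbhs_infty_gt.
have nR : 0 < n%:R :> R by rewrite ltr0n.
have Cn : C <= e / 2 * n%:R.
  rewrite -ler_pdivrMl ?divr_gt0//; near: n; exact: nbhs_infty_ger.
rewrite distrC ger0_norm; last by rewrite subr_ge0 ler_pdivlMr.
rewrite lerBlDl ler_pdivrMr//.
have : b n <= (n %/ m.+1)%:R * b m.+1 + C.
  rewrite {1}(divn_eq n m.+1); apply: le_trans (b_mul _ _ _) _.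
  rewrite lerD2l; apply: le_trans (b_lin _) _.
  rewrite lerD2l ler_wpM2r// ler_nat; apply: ltnW; exact: ltn_pmod.
have : (n %/ m.+1)%:R * b m.+1 <= (inf S + e / 2) * n%:R.
  have bm' : b m.+1 <= (inf S + e / 2) * m.+1%:R.
    by rewrite -ler_pdivrMr ?ltr0n// ltW.
  apply: (@le_trans _ _ ((n %/ m.+1)%:R * ((inf S + e / 2) * m.+1%:R))).
    by rewrite ler_wpM2l.
  have L0 : 0 <= inf S + e / 2.
    by apply: le_trans (ltW bm); rewrite divr_ge0.
  rewrite mulrCA ler_wpM2l// -natrM ler_nat; exact: leq_trunc_div.
by rewrite !mulrDl; have := mulrDl (e / 2) (e / 2) n%:R; rewrite -splitr; lra.
Unshelve. all: by end_near. Qed.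

Lemma banach_count_nat (R : realType) (A : set nat) (N : nat) : exists b : nat,
  [/\ @banach_count R A N = b%:R%:E,
      frequently (fun k => (b <= card_between A (k + 1) (k + N))%N)
    & ~ frequently (fun k => (b < card_between A (k + 1) (k + N))%N)].
Proof.
pose P m := `[< frequently (fun k => (m <= card_between A (k + 1) (k + N))%N) >].
have exP : exists m, P m by exists 0%N; apply/asboolP => M; exists M.
have ubP m : P m -> (m <= N)%N.
  move=> /asboolP/(_ 0%N)[k _] /leq_trans; apply; exact: card_between_le.
case: (ex_maxnP exP ubP) => b /asboolP fb maxb; exists b.
have nfb : ~ frequently (fun k => (b < card_between A (k + 1) (k + N))%N).
  by move=> fb'; have := maxb b.+1 (asboolT fb'); rewrite ltnn.
by split => //; apply: limn_esup_nat.
Qed.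

(** Splitting a window of length [M + N] in two makes [banach_count]
    subadditive, so that the limit defining the upper Banach density exists and
    is an infimum: this turns its positivity into a bound for every length. *)
Lemma upper_banach_density_gt0P (R : realType) (A : set nat) :
  (0 < @upper_banach_density R A)%E <->
  exists2 c : R, 0 < c & forall N, frequently (fun k =>
    c * N%:R <= (card_between A (k + 1) (k + N))%:R).
Proof.
have [b bP] := choice (banach_count_nat R A).
have bD m n : ((b (m + n)%N)%:R : R) <= (b m)%:R + (b n)%:R.
  rewrite -natrD ler_nat; have [_ fmn _] := bP (m + n)%N.
  have [_ _ /not_frequently[Mm Hm]] := bP m.
  have [_ _ /not_frequently[Mn Hn]] := bP n.
  have [k] := fmn (maxn Mm Mn); rewrite geq_max => /andP[kMm kMn].
  move=> /leq_trans; apply; rewrite card_between_cat leq_add//.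
    by rewrite leqNgt; apply/negP/Hm.
  by rewrite leqNgt; apply/negP/Hn; rewrite (leq_trans kMn)// leq_addr.
have [L bL Lb] := fekete (fun n => ler0n R (b n)) bD.
have -> : @upper_banach_density R A = L%:E.
  apply/cvg_lim => //; rewrite (_ : (fun _ => _) =
    (fun n => (((b n)%:R : R) * n%:R^-1)%:E)); first by apply/cvg_EFin; [near=> n|].
  by apply/funext => n; have [-> _ _] := bP n.
rewrite lte_fin; split=> [L0|[c c0 cA]].
  exists L => // N; have [_ fb _] := bP N.
  apply: frequentlyS fb => k; rewrite -(ler_nat R); exact: le_trans.
apply: (lt_le_trans c0); apply: cvgr_to_ge bL _.
near=> N; have N0 : (0 < N)%N by near: N; exact: nbhs_infty_gt.
rewrite ler_pdivlMr ?ltr0n//.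
have [_ _ /not_frequently[M HM]] := bP N; have [k Mk] := cA N M.
move=> /le_trans; apply; rewrite ler_nat leqNgt; exact/negP/HM.
Unshelve. all: by end_near. Qed.

(** * Comparison of the densities of a fixed set *)

Lemma exprD1_le_expR1 (R : realType) (x : R) (n : nat) :
  0 <= x -> x * n%:R <= 1 -> (1 + x) ^+ n <= expR 1.
Proof.
move=> x0 xn; apply: (@le_trans _ _ (expR x ^+ n)).
  by rewrite lerXn2r ?nnegrE ?expR_ge0 ?expR_ge1Dx// addr_ge0.
by rewrite -expRM_natr ler_expR.
Qed.

Lemma geometric_le (R : realType) (u : R^nat) (q : R) (M : nat) : 0 <= q ->
    (forall n, (M <= n)%N -> u n.+1 <= q * u n) ->
  forall n N, (M <= n)%N -> u (n + N)%N <= q ^+ N * u n.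
Proof.
move=> q0 uq n N Mn; elim: N => [|N IH]; first by rewrite addn0 mul1r.
rewrite addnS exprS -mulrA; apply: le_trans (uq _ _) _.
  by rewrite (leq_trans Mn)// leq_addr.
by rewrite ler_wpM2l.
Qed.

Section WeightedSums.
Context {R : realType}.
Implicit Types (a : R^nat) (A : set nat).

Local Notation psum a n := (\sum_(0 <= j < n) a j).
Local Notation wsum a A n := (\sum_(0 <= j < n) a j * \1_A j).

Lemma psum_ge0 a n : (forall i, 0 <= a i) -> 0 <= psum a n.
Proof. by move=> a0; apply: sumr_ge0. Qed.

Lemma le_psum a : (forall i, 0 <= a i) -> nondecreasing_seq (fun n => psum a n).
Proof.
by move=> a0; apply/nondecreasing_seqP => n; rewrite big_nat_recr //= lerDl.
Qed.

Lemma indic01 A j : 0 <= (\1_A j : R) <= 1.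
Proof. by rewrite indicE ler0n lern1; case: (j \in A). Qed.

Lemma le_wsum a A : (forall i, 0 <= a i) -> nondecreasing_seq (fun n => wsum a A n).
Proof.
move=> a0; apply/nondecreasing_seqP => n; rewrite big_nat_recr //= lerDl.
by rewrite mulr_ge0//; have /andP[] := indic01 A n.
Qed.

Lemma wsum_le_psum a A n : (forall i, 0 <= a i) -> wsum a A n <= psum a n.
Proof.
by move=> a0; apply: ler_sum => j _; rewrite ler_piMr//; have /andP[] := indic01 A j.
Qed.

Lemma near_le_psum a (C : R) : classS a -> \forall n \near \oo, C <= psum a n.
Proof.
move=> [a0 _ /cvgryPge/(_ C)[M _ aM] _ _]; exists M.+1 => // -[|n]//= Mn.
rewrite big_nat_recr //= (le_trans (aM n Mn))// lerDr; exact: psum_ge0.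
Qed.

(** Both the weights and their partial sums grow subexponentially: the partial
    sums because [v a] tends to [0], the weights because monotonicity of [v a]
    bounds the ratio of consecutive weights by that of consecutive sums. *)
Lemma classS_growth a (e : R) : classS a -> 0 < e ->
  \forall n \near \oo, a n.+1 <= (1 + e) * a n /\
    psum a n.+1 <= (1 + e) * psum a n.
Proof.
move=> Sa e0; have := Sa => -[a0 _ _ va v0]; near=> n.
have P0 : 0 < psum a n.
  apply: (@lt_le_trans _ _ 1) => //; near: n; exact: near_le_psum.
have P1 : psum a n <= psum a n.+1 by exact: le_psum.
have P1_gt0 := lt_le_trans P0 P1.
have ae : a n <= e * psum a n.
  rewrite -ler_pdivrMr// -[_ / _]/(v a n) (le_trans (ler_norm _))// -normrN -sub0r.
  by near: n; move/cvgrPdist_le : v0; apply.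
have Pe : psum a n.+1 <= (1 + e) * psum a n.
  by rewrite big_nat_recr //= mulrDl mul1r lerD2l.
split=> //.
have := va _ _ (leqnSn n) P0 P1_gt0.
rewrite /v ler_pdivrMr// -mulrA [_^-1 * _]mulrC => /le_trans; apply.
rewrite [leRHS]mulrC ler_wpM2l// ler_pdivrMr//.
Unshelve. all: by end_near. Qed.

Lemma classS_shift a (N : nat) : classS a ->
  \forall n \near \oo, a (n + N)%N <= expR 1 * a n /\
    psum a (n + N)%N <= expR 1 * psum a n.
Proof.
move=> Sa; have [a0 _ _ _ _] := Sa.
have [|M _ aM] := @classS_growth a N.+1%:R^-1 Sa; first by rewrite invr_gt0.
pose q : R := 1 + N.+1%:R^-1.
have q0 : 0 <= q by rewrite addr_ge0// invr_ge0.
have qN : q ^+ N <= expR 1.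
  by apply: exprD1_le_expR1; rewrite ?invr_ge0// mulrC ler_pdivrMr// mul1r ler_nat.
exists M => //= n Mn; split.
  apply: le_trans (geometric_le q0 (fun n Mn => (aM n Mn).1) N Mn) _.
  by rewrite ler_wpM2r.
have Pq := @geometric_le _ (fun n => psum a n) _ _ q0 (fun n Mn => (aM n Mn).2).
apply: le_trans (Pq n N Mn) _.
by rewrite ler_wpM2r// psum_ge0.
Qed.

(** Dividing by the non-decreasing weights is an Abel summation with
    non-increasing multipliers, so a bound [wsum a A n <= e * psum a n] valid
    from some point on passes to plain counting, up to a bounded error. *)
Lemma upper_density_gt0_weighted a A : classS a ->
  (0 < @upper_density R A)%E -> (0 < upper_weighted_density a A)%E.
Proof.
move=> Sa /limn_esup_gt0P[c c0 cA]; apply/limn_esup_gt0P.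
exists (c / 2); first lra.
have [a0 mono_a aoo _ _] := Sa.
apply: contrapT => /not_frequently[M1 HM1].
have [M2 _ aM2] : \forall n \near \oo, 1 <= a n by move/cvgryPge : aoo; apply.
have [M3 _ PM3] := near_le_psum 1 Sa.
pose M := (maxn M1 (maxn M2 M3)).+1.
pose g n := c / 2 * psum a n - wsum a A n.
have a_gt0 n : (M <= n)%N -> 0 < a n.
  by move=> Mn; apply: (lt_le_trans ltr01); apply: aM2 => /=; rewrite /M in Mn; lia.
have g0 n : (M <= n)%N -> 0 <= g n.
  case: n => // n Mn; rewrite subr_ge0.
  have P0 : 0 < psum a n.+1.
    by apply: (lt_le_trans ltr01); apply: PM3 => /=; rewrite /M in Mn; lia.
  rewrite -ler_pdivrMr// leNgt; apply/negP => /ltW; apply: HM1.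
  by rewrite /M in Mn; lia.
(* The increment of [g] at [n] is [a n * (c / 2 - \1_A n)], and replacing
   [1 / a n] by the smaller [1 / a n.+1] in front of [g n.+1 >= 0] only
   decreases the left-hand side. *)
have abel n : g (M + n)%N / a (M + n)%N - g M / a M <=
    c / 2 * n%:R - \sum_(M <= j < M + n) \1_A j.
  elim: n => [|n IH]; first by rewrite addn0 mulr0 big_geq// !subrr.
  have := g0 (M + n).+1 (leq_trans (leq_addr n M) (leqnSn _)).
  have gS : g (M + n).+1 = g (M + n)%N + a (M + n)%N * (c / 2 - \1_A (M + n)%N).
    by rewrite /g !(big_nat_recr (M + n))//=; ring.
  have an := a_gt0 (M + n)%N (leq_addr _ _).
  move=> gS0; rewrite addnS big_nat_recr ?leq_addr//=.
  have : g (M + n).+1 / a (M + n).+1 <= g (M + n).+1 / a (M + n)%N.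
    by rewrite ler_wpM2l// lef_pV2 ?posrE ?mono_a// a_gt0// -addnS leq_addr.
  have -> : g (M + n).+1 / a (M + n)%N =
      g (M + n)%N / a (M + n)%N + (c / 2 - \1_A (M + n)%N).
    by rewrite gS; field; rewrite gt_eqF.
  rewrite -[n.+1%:R]natr1; lra.
pose C := M%:R + g M / a M.
have bnd n : \sum_(0 <= j < M + n) (\1_A j : R) <= C + c / 2 * n%:R.
  rewrite (@big_cat_nat _ _ _ M)//= ?leq_addr//.
  have : \sum_(0 <= j < M) (\1_A j : R) <= M%:R.
    rewrite -[leRHS](_ : \sum_(0 <= j < M) 1 = _).
      by apply: ler_sum => j _; have /andP[] := indic01 A j.
    by rewrite big_const_nat iter_addr_0 subn0.
  have := abel n; have : 0 <= g (M + n)%N / a (M + n)%N.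
    by rewrite divr_ge0// g0// leq_addr.
  rewrite /C; lra.
(* For [n >= 4 * C / c] the bound [C + c / 2 * n.+1] falls below [c * n.+1]. *)
have [K _ CK] := nbhs_infty_ger (C / (c / 4)).
have [n] := cA (maxn M K); rewrite geq_max => /andP[Mn Kn].
rewrite ler_pdivlMr ?ltr0n// card_betweenR -(subnKC (leqW Mn)) => cn.
have := CK n Kn; rewrite ler_pdivrMr; last lra.
have := le_trans cn (bnd _).
have : ((n.+1 - M)%:R : R) <= n.+1%:R by rewrite ler_nat leq_subr.
have : 0 < c * n.+1%:R by rewrite mulr_gt0.
rewrite (subnKC (leqW Mn)) -natr1; nra.
Qed.

Lemma sum_nat_succ n : (\sum_(0 <= j < n) j.+1%:R : R) = n%:R * n.+1%:R / 2.
Proof.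
elim: n => [|n IH]; first by rewrite big_geq// mul0r mul0r.
by rewrite big_nat_recr//= IH -!natr1; field.
Qed.

Lemma classS_succ : classS (fun n => n.+1%:R : R).
Proof.
have vE n : (0 < n)%N -> v (fun n => n.+1%:R : R) n = 2 / n%:R.
  move=> n0; rewrite /v sum_nat_succ; field.
  by rewrite addrC natr1 !pnatr_eq0 -lt0n n0.
split.
- by [].
- by move=> m n mn; rewrite ler_nat ltnS.
- apply/cvgryPge => C; have [K _ CK] := nbhs_infty_ger C.
  by exists K => // n Kn; apply: CK => /=; exact: leqW.
- move=> m n mn; rewrite !sum_nat_succ => m0 n0.
  have mgt : (0 < m)%N by case: m m0 {mn} => //; rewrite !mul0r ltxx.
  rewrite !vE// ?(leq_trans mgt)//.
  by rewrite ler_wpM2l// lef_pV2 ?posrE ?ltr0n ?ler_nat// (leq_trans mgt).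
- apply/cvgrPdist_le => e e0; near=> n.
  have n0 : (0 < n)%N by near: n; exact: nbhs_infty_gt.
  rewrite sub0r normrN vE// ger0_norm ?divr_ge0//.
  rewrite ler_pdivrMr ?ltr0n// -ler_pdivrMl// mulrC.
  near: n; exact: nbhs_infty_ger.
Unshelve. all: by end_near. Qed.

(** The weights [j + 1] with [j <= n] are bounded by [n + 1], while they sum to
    [(n + 1) * (n + 2) / 2]; so the weighted ratio is at most about twice the
    plain one. *)
Lemma weighted_succ_gt0_upper_density A :
  (0 < upper_weighted_density (fun n => n.+1%:R : R) A)%E ->
  (0 < @upper_density R A)%E.
Proof.
move=> /limn_esup_gt0P[c c0 cA]; apply/limn_esup_gt0P; exists (c / 2); first lra.
apply: frequentlyS cA => n; rewrite sum_nat_succ.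
have n1 : 0 < n.+1%:R :> R by rewrite ltr0n.
have n2 : 0 < n.+2%:R :> R by rewrite ltr0n.
rewrite !ler_pdivlMr ?mulr_gt0// card_betweenR => cn.
have : \sum_(0 <= j < n.+1) j.+1%:R * \1_A j <=
    n.+1%:R * \sum_(0 <= j < n.+1) (\1_A j : R).
  rewrite mulr_sumr; apply: ler_sum_nat => j /andP[_ jn].
  by rewrite ler_wpM2r ?ler_nat//; have /andP[] := indic01 A j.
move=> /(le_trans cn).
have -> : c * (n.+1%:R * n.+2%:R / 2) = n.+1%:R * (c / 2 * n.+2%:R) by ring.
rewrite ler_pM2l//; apply: le_trans.
by rewrite ler_wpM2l ?ler_nat// divr_ge0// ltW.
Qed.

(** Along windows of a fixed length the weights and their sums vary by a
    bounded factor, so counting few points of [A] in every late window keeps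
    the weighted sums over [A] small as well. *)
Lemma weighted_gt0_upper_banach a A : classS a ->
  (0 < upper_weighted_density a A)%E -> (0 < @upper_banach_density R A)%E.
Proof.
move=> Sa /limn_esup_gt0P[c c0 cA]; apply/upper_banach_density_gt0P.
have [a0 mono_a aoo _ _] := Sa.
have E0 : 0 < expR 1 :> R by exact: expR_gt0.
set E : R := expR 1 in E0 *.
(* One factor [E] is lost inside a window, the other in completing the last,
   partial window. *)
pose c' := c / (2 * E ^+ 2).
have c'0 : 0 < c' by rewrite divr_gt0// mulr_gt0// exprn_gt0.
exists c' => // N; apply: contrapT => /not_frequently[M1 HM1].
have [M2 _ aM2] := classS_shift N Sa.
have N0 : (0 < N)%N.
  case: N HM1 {aM2} => // /(_ M1 (leqnn _)) H; exfalso; apply: H.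
  by rewrite mulr0 ler0n.
pose M := maxn M1 M2.
have block k : (M <= k)%N -> \sum_(k + 1 <= j < k + 1 + N) a j * \1_A j <=
    E * c' * \sum_(k + 1 <= j < k + 1 + N) a j.
  move=> Mk.
  have M1k : (M1 <= k)%N by rewrite (leq_trans _ Mk)// leq_maxl.
  have M2k : (M2 <= k)%N by rewrite (leq_trans _ Mk)// leq_maxr.
  have kN : (k + 1 + N = (k + N).+1)%N by lia.
  apply: (@le_trans _ _ (a (k + N)%N * (card_between A (k + 1) (k + N))%:R)).
    rewrite card_betweenR kN mulr_sumr.
    apply: ler_sum_nat => j /andP[_ jn].
    by rewrite ler_wpM2r ?mono_a//; have /andP[] := indic01 A j.
  apply: (@le_trans _ _ (E * a k * (c' * N%:R))).
    apply: ler_pM => //; first by have [] := aM2 k M2k.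
    by rewrite leNgt; apply/negP => /ltW; exact: HM1.
  rewrite -[leLHS]mulrA [a k * _]mulrCA -[leRHS]mulrA !ler_pM2l//.
  apply: (@le_trans _ _ (\sum_(k + 1 <= j < k + 1 + N) a k)).
    by rewrite sumr_const_nat mulr_natr addKn.
  apply: ler_sum_nat => j /andP[kj _]; apply: mono_a; lia.
have blocks q : wsum a A (M.+1 + q * N) <=
    psum a M.+1 + E * c' * psum a (M.+1 + q * N).
  elim: q => [|q IH].
    rewrite mul0n addn0 (le_trans (wsum_le_psum _ _ a0))// lerDl.
    by rewrite mulr_ge0 ?psum_ge0// mulr_ge0// ltW.
  have e : (M.+1 + q.+1 * N = (M + q * N) + 1 + N)%N by lia.
  have e' : (M.+1 + q * N = (M + q * N) + 1)%N by lia.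
  rewrite e !(@big_cat_nat _ _ _ ((M + q * N) + 1)%N 0%N _ _ _ _ (leq_addr N _))//=.
  rewrite -e' mulrDr addrA lerD// e' block//; exact: leq_addr.
have [K _ PK] := near_le_psum (psum a M.+1 * 4 / c + 1) Sa.
have [n] := cA (maxn (maxn M.+1 K) M2); rewrite !geq_max => /andP[/andP[Mn Kn] M2n].
have {PK Kn} Pn := PK n.+1 (leqW Kn).
have C0 : 0 <= psum a M.+1 := psum_ge0 _ a0.
have P0 : 0 < psum a n.+1.
  apply: lt_le_trans Pn; rewrite ltr_wpDl// divr_ge0 ?mulr_ge0// ltW//.
rewrite ler_pdivlMr// => cn.
(* [q] windows after [M] reach [n.+1] and exceed it by at most [N]. *)
pose q := ((n.+1 - M.+1) %/ N).+1.
have qn : (n.+1 <= M.+1 + q * N)%N.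
  rewrite -leq_subLR; apply: ltnW; exact: ltn_ceil.
have nq : (M.+1 + q * N <= n.+1 + N)%N.
  rewrite /q mulSn; have := leq_trunc_div (n.+1 - M.+1) N; lia.
have h : E * psum a (M.+1 + q * N) <= E ^+ 2 * psum a n.+1.
  rewrite expr2 -mulrA ler_pM2l//; apply: le_trans (le_psum a0 nq) _.
  by have [] := aM2 n.+1 (leqW M2n).
have h2 : E * c' * psum a (M.+1 + q * N) <= c / 2 * psum a n.+1.
  rewrite mulrAC; apply: (@le_trans _ _ (E ^+ 2 * psum a n.+1 * c')).
    by rewrite ler_wpM2r// ltW.
  by rewrite /c' le_eqVlt; apply/orP; left; apply/eqP; field; rewrite gt_eqF.
have := le_trans cn (le_trans (le_wsum A a0 qn) (blocks q)).
move: Pn; rewrite -lerBrDr ler_pdivrMr// => Pn.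
nra.
Qed.

End WeightedSums.

(** * Weights with [v] prescribed by a step function *)

Section StepWeights.
Context {R : realType}.
Context (w : nat -> nat) (w0 : w 0%N = 1%N) (w1 : w 1%N = 1%N)
  (wS : forall n, (w n <= w n.+1 <= (w n).+1)%N)
  (w_sqr : forall n, (0 < n)%N -> (w n * w n <= n)%N)
  (w_unbounded : forall C, exists n, (C <= w n)%N).

(** The recursion for [step_sum] is [P (n + 1) = (1 + v n) * P n] with
    [v n = 1 / w n]; starting the product at [1] makes [step_sum n] the sum of
    the first [n] weights for [0 < n]. *)
Definition step_sum n : R := \prod_(1 <= j < n) (1 + (w j)%:R^-1).

Definition step_weight n : R := step_sum n / (w n)%:R.

Lemma w_homo m n : (m <= n)%N -> (w m <= w n)%N.
Proof.
have wn n' : (w n' <= w n'.+1)%N by have /andP[] := wS n'.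
by move/(homo_leq leqnn leq_trans wn).
Qed.

Lemma w_gt0 n : (0 < w n)%N.
Proof. by rewrite -w0 w_homo. Qed.

Lemma wR_gt0 n : 0 < (w n)%:R :> R.
Proof. by rewrite ltr0n w_gt0. Qed.

Lemma step_sumS n : (0 < n)%N ->
  step_sum n.+1 = step_sum n * (1 + (w n)%:R^-1).
Proof. by move=> n0; rewrite /step_sum big_nat_recr. Qed.

Lemma step_sum_gt0 n : 0 < step_sum n.
Proof.
by apply: prodr_gt0 => j _; rewrite ltr_wpDr// invr_ge0.
Qed.

Lemma step_weight_gt0 n : 0 < step_weight n.
Proof. by rewrite divr_gt0 ?step_sum_gt0 ?wR_gt0. Qed.

Lemma sum_step_weight n : (0 < n)%N -> \sum_(0 <= j < n) step_weight j = step_sum n.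
Proof.
case: n => // n _; elim: n => [|n IH].
  by rewrite big_nat1 /step_weight /step_sum !big_geq// w0 divr1.
by rewrite big_nat_recr//= IH (@step_sumS n.+1)// mulrDr mulr1.
Qed.

(** The ratio of consecutive weights is [((w n) + 1) / w (n + 1)], which is at
    least [1] because [w] never jumps by more than one. *)
Lemma step_weight_homo : nondecreasing_seq step_weight.
Proof.
apply/nondecreasing_seqP => -[|n].
  by rewrite /step_weight /step_sum !big_geq// w0 w1.
rewrite /step_weight (@step_sumS n.+1)// -mulrA ler_pM2l ?step_sum_gt0//.
rewrite ler_pdivlMr ?wR_gt0//.
have -> : 1 + (w n.+1)%:R^-1 = (w n.+1)%:R^-1 * (w n.+1).+1%:R :> R.
  by rewrite -[(w n.+1).+1%:R]natr1 mulrDr mulr1 mulVf// gt_eqF// wR_gt0.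
rewrite ler_pM2l ?invr_gt0 ?wR_gt0// ler_nat.
by have /andP[] := wS n.+1.
Qed.

Lemma v_step_weight n : (0 < n)%N -> v step_weight n = (w n)%:R^-1.
Proof.
move=> n0; rewrite /v sum_step_weight// /step_weight mulrAC divff ?mul1r//.
by rewrite gt_eqF// step_sum_gt0.
Qed.

(** The weights are at least [1], so [step_sum n >= n >= (w n) ^ 2]: the slow
    growth of [w] is what makes the weights unbounded. *)
Lemma w_le_step_weight n : (0 < n)%N -> (w n)%:R <= step_weight n.
Proof.
move=> n0; rewrite ler_pdivlMr ?wR_gt0// -natrM.
apply: (@le_trans _ _ n%:R); first by rewrite ler_nat w_sqr.
rewrite -sum_step_weight// -[leLHS](_ : \sum_(0 <= j < n) 1 = _).
  apply: ler_sum => j _; apply: le_trans (step_weight_homo (leq0n j)).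
  by rewrite /step_weight /step_sum big_geq// w0 divr1.
by rewrite sumr_const_nat subn0.
Qed.

Lemma near_le_w (C : R) : \forall n \near \oo, C <= (w n)%:R.
Proof.
have [K _ CK] := nbhs_infty_ger C.
have [M KM] := w_unbounded K.
exists M => // n /= Mn; apply: CK => /=; exact: leq_trans KM (w_homo Mn).
Qed.

Lemma classS_step_weight : classS step_weight.
Proof.
split.
- by move=> n; exact/ltW/step_weight_gt0.
- exact: step_weight_homo.
- apply/cvgryPge => C; near=> n; apply: (@le_trans _ _ (w n)%:R).
    by near: n; exact: near_le_w.
  by rewrite w_le_step_weight//; near: n; exact: nbhs_infty_gt.
- move=> m n mn m0 _; have {}m0 : (0 < m)%N.
    by case: m m0 {mn} => //; rewrite big_geq ?ltxx.
  rewrite !v_step_weight//; last exact: leq_trans mn.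
  by rewrite lef_pV2 ?posrE ?wR_gt0// ler_nat w_homo.
- apply/cvgrPdist_le => e e0; near=> n.
  rewrite sub0r normrN v_step_weight; last by near: n; exact: nbhs_infty_gt.
  rewrite ger0_norm ?invr_ge0// invf_ple ?posrE ?wR_gt0//.
  near: n; exact: near_le_w.
Unshelve. all: by end_near. Qed.

(** On a window of length [N] where [w] equals [N], the sums grow by the factor
    [(1 + 1/N) ^ N <= e], so the window carries a fixed share of the total
    weight up to its end, spread evenly up to the factor [e]. *)
Lemma step_weight_window (A : set nat) (c : R) (k N : nat) : (0 < N)%N -> 0 <= c ->
    (forall j, (k < j <= k + N)%N -> w j = N) ->
    c * N%:R <= (card_between A (k + 1) (k + N))%:R ->
  c / expR 1 <= (\sum_(0 <= j < (k + N).+1) step_weight j * \1_A j) /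
                (\sum_(0 <= j < (k + N).+1) step_weight j).
Proof.
move=> N0 c0 wN cN; have N0' : 0 < N%:R :> R by rewrite ltr0n.
have c_le : c * step_sum k.+1 <=
    \sum_(0 <= j < (k + N).+1) step_weight j * \1_A j.
  rewrite (@big_cat_nat _ _ _ (k + 1)%N)//=; last by lia.
  apply: ler_wpDl.
    by apply: sumr_ge0 => j _; rewrite mulr_ge0// ltW// step_weight_gt0.
  apply: (@le_trans _ _ (step_weight k.+1 * (card_between A (k + 1) (k + N))%:R)).
    rewrite {1}/step_weight wN ?ltnSn ?addn1; last by lia.
    rewrite mulrAC ler_pdivlMr// mulrAC mulrC ler_pM2l ?step_sum_gt0//.
    by rewrite -[k.+1]addn1.
  rewrite card_betweenR mulr_sumr.
  apply: ler_sum_nat => j /andP[kj _]; rewrite ler_wpM2r//.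
  by apply: step_weight_homo; rewrite -addn1.
rewrite sum_step_weight// ler_pdivlMr ?step_sum_gt0//.
have growth i : (i <= N)%N ->
    step_sum (k.+1 + i)%N = (1 + N%:R^-1) ^+ i * step_sum k.+1.
  elim: i => [_|i IH iN]; first by rewrite addn0 mul1r.
  rewrite addnS step_sumS// IH ?(ltnW iN)// wN; last by lia.
  by rewrite exprS; ring.
apply: le_trans c_le; rewrite -addSn growth//.
rewrite mulrA ler_pM2r ?step_sum_gt0// mulrAC ler_pdivrMr ?expR_gt0//.
by rewrite ler_wpM2l// exprD1_le_expR1 ?invr_ge0// mulVf// gt_eqF.
Qed.

End StepWeights.

(** * One sequence of weights for countably many sets *)

Lemma logn2_pow_odd (i m : nat) : logn 2 (2 ^ i * m.*2.+1) = i.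
Proof.
rewrite lognM ?expn_gt0// lognX logn_prime//= muln1.
by rewrite lognE/= dvdn2 /= odd_double addn0.
Qed.

(** The integer [N] serves the set of index [logn 2 N], so that each set is
    served by infinitely many window lengths. The step on which [w] equals
    [N] ends with a window of length [N] rich in points of the set served by [N],
    and begins late enough for [w n ^ 2 <= n]. *)
Lemma exists_classS_weighted_gt0 (R : realType)
    (A : nat -> set nat) : (forall i, 0 < @upper_banach_density R (A i))%E ->
  exists2 a : R^nat, classS a & forall i, (0 < upper_weighted_density a (A i))%E.
Proof.
move=> BA.
have /choice[c cP] i : exists c : R, 0 < c /\ forall N, frequently (fun k =>
    c * N%:R <= (card_between (A i) (k + 1) (k + N))%:R).
  by have /upper_banach_density_gt0P[c ? ?] := BA i; exists c.
have /choice[f fP] (Nm : nat * nat) : exists k, (Nm.2 <= k)%N /\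
    c (logn 2 Nm.1) * Nm.1%:R <=
      (card_between (A (logn 2 Nm.1)) (k + 1) (k + Nm.1))%:R.
  by have [k ? ?] := (cP (logn 2 Nm.1)).2 Nm.1 Nm.2; exists k.
pose start s es := f (s.+2, es + s.+3 * s.+3)%N.
(* [e s] is the last index at which the step function [w] equals [s + 1]. The
   value [2 ^ 2] at [s = 0] and the term [(s + 3) ^ 2] ensure that the next
   step, where [w] equals [s + 2], lies beyond [(s + 2) ^ 2]. *)
pose fix e s := if s is s'.+1 then (start s' (e s') + s'.+2)%N else 4%N.
have start_ge s : (e s + s.+3 * s.+3 <= start s (e s))%N.
  by have [] := fP (s.+2, e s + s.+3 * s.+3)%N.
have e_ge s : (s.+2 * s.+2 <= e s)%N.
  case: s => // s; have := start_ge s; rewrite [e s.+1]/=; lia.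
have e_lt s : (e s < e s.+1)%N by have := start_ge s; rewrite [e s.+1]/=; lia.
have e_homo s t : (s <= t)%N -> (e s <= e t)%N.
  by apply: (homo_leq leqnn leq_trans) => s'; exact: ltnW.
have ex_e n : exists s, (n <= e s)%N.
  by exists n; have := e_ge n; lia.
pose w n := (ex_minn (ex_e n)).+1.
have w_le n s : (w n <= s.+1)%N = (n <= e s)%N.
  rewrite /w ltnS; case: ex_minnP => t nt mint.
  by apply/idP/idP => [/e_homo/(leq_trans nt)|/mint].
have w0 : w 0%N = 1%N by apply/eqP; rewrite eqn_leq w_le.
have w1 : w 1%N = 1%N by apply/eqP; rewrite eqn_leq w_le.
have wS n : (w n <= w n.+1 <= (w n).+1)%N.
  apply/andP; split.
    have : (w n.+1 <= w n.+1)%N by [].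
    by rewrite {2 4}/w !w_le; exact: ltnW.
  rewrite {2}/w w_le.
  have : (w n <= w n)%N by [].
  by rewrite {2}/w w_le => /leq_ltn_trans; apply.
have w_sqr n : (0 < n)%N -> (w n * w n <= n)%N.
  move=> n0; case wn : (w n) => [|[|s]] //.
  have : ~~ (w n <= s.+1)%N by rewrite wn ltnn.
  by rewrite w_le -ltnNge => /ltnW; exact: leq_trans (e_ge s).
have w_unbounded C : exists n, (C <= w n)%N.
  exists (e C).+1; rewrite leqNgt; apply/negP => /ltnW/leqW.
  by rewrite w_le ltnn.
have Sw := classS_step_weight (R := R) w0 w1 wS w_sqr w_unbounded.
exists (step_weight w) => // i; apply/limn_esup_gt0P.
have [ci0 _] := cP i.
exists (c i / expR 1); first by rewrite divr_gt0// expR_gt0.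
(* A window length beyond [M] that serves [A i]; it is the value of [w] on the
   step ending at [e s.+1], and this step contains the window. *)
move=> M; pose N := (2 ^ i * M.+1.*2.+1)%N.
have NM : (M.+2 <= N)%N.
  by rewrite (leq_trans _ (leq_pmull _ _)) ?expn_gt0//; lia.
pose s := (N - 2)%N; have sN : N = s.+2 by rewrite /s; lia.
have [/= _ kN] := fP (s.+2, e s + s.+3 * s.+3)%N.
rewrite -/(start s (e s)) -sN logn2_pow_odd in kN.
exists (start s (e s) + N)%N; first by lia.
apply: step_weight_window => //; [lia|exact: ltW| ].
move=> j /andP[kj jN]; apply/eqP; rewrite eqn_leq {1}sN w_le /= -sN jN /=.
rewrite sN ltnNge w_le -ltnNge (leq_ltn_trans _ kj)// (leq_trans _ (start_ge s))//.
exact: leq_addr.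
Qed.

(** * Sets of hypercyclic vectors *)

(** A complex number that is positive for the order of [R[i]] is real, so the
    complex case is the real one. *)
Lemma real_or_complex_archimedean (R : realType) (K : numFieldType) (x : K) :
  real_or_complex R K -> 0 < x -> exists n, n.+1%:R^-1 < x.
Proof.
have archR (y : R) : 0 < y -> exists n, n.+1%:R^-1 < y.
  move=> y0; exists (Num.trunc y^-1).
  by rewrite invf_plt ?posrE ?ltr0n// truncnS_gt.
move=> hK; case: hK x => [|] x; first exact: archR.
rewrite ltcE => /andP[/eqP Imx /archR[n nx]]; exists n.
have -> : x = (complex.Re x)%:C%C by case: x Imx {nx} => ? ? /= ->.
by rewrite -(rmorph_nat (real_complex R)) -fmorphV ltcR.
Qed.

(** A ball around [x] of radius [e] contains the ball of radius [r < e / 2]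
    around any point of a dense set at distance less than [r] from [x]. *)
Lemma countable_pi_base (R : realType) (K : numFieldType) (X : normedModType K) :
    real_or_complex R K -> separable X ->
  exists B : nat -> set X, (forall i, open (B i) /\ B i !=set0) /\
    forall U, open U -> U !=set0 -> exists i, B i `<=` U.
Proof.
move=> hK [D /countable_injP[f injf] denseD].
(* [g] enumerates [D]: it is a left inverse of [f] on [D]. *)
pose g m := xget 0 [set d | D d /\ f d = m].
have gK d : D d -> g (f d) = d.
  move=> Dd; have [Dg fg] : D (g (f d)) /\ f (g (f d)) = f d.
    by apply: (@xgetPex _ 0 [set d' | D d' /\ f d' = f d]); exists d.
  by apply: injf => //; exact/mem_set.
pose r k : K := k.+1%:R^-1.
have r0 k : 0 < r k by rewrite invr_gt0 ltr0n.
pose B (i : nat) :=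
  let mk := odflt (0%N, 0%N) (choice.unpickle i) in
  ball (g mk.1) (r mk.2).
exists B; split=> [i|U oU [x Ux]].
  split; first exact: ball_open.
  by exists (g (odflt (0%N, 0%N) (choice.unpickle i)).1); exact: ballxx.
have /nbhs_ballP[e /= e0 eU] : nbhs x U by exact: open_nbhs_nbhs.
have [k ke] := real_or_complex_archimedean hK (divr_gt0 e0 (ltr0Sn K 1)).
have [d [xd Dd]] : ball x (r k) `&` D !=set0.
  by apply: denseD (ball_open _ _); exists x; exact: ballxx.
exists (choice.pickle (f d, k)); rewrite /B choice.pickleK /= gK// => y dy.
apply: eU; apply: le_ball (ball_triangle xd dy).
by rewrite [leRHS]splitr lerD// ltW.
Qed.

Section Orbits.
Context {R : realType} {X : topologicalType}.

Lemma UFHC_bigcap (T : X -> X) :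
  UFHC R T = \bigcap_(a in @classS R) UFHC_wrt a T.
Proof.
apply/seteqP; split=> x Tx; [move=> a Sa U oU U0|move=> U oU U0].
  by apply: upper_density_gt0_weighted => //; exact: Tx.
by apply: weighted_succ_gt0_upper_density; exact: (Tx _ classS_succ).
Qed.

Lemma weighted_gt0_subset (a : R^nat) (A B : set nat) :
  (forall n, 0 <= a n) -> A `<=` B -> (0 < upper_weighted_density a A)%E ->
  (0 < upper_weighted_density a B)%E.
Proof.
move=> a0 AB /limn_esup_gt0P[c c0 cA]; apply/limn_esup_gt0P; exists c => //.
apply: frequentlyS cA => n /le_trans; apply.
rewrite ler_wpM2r ?invr_ge0 ?psum_ge0//; apply: ler_sum => j _.
rewrite ler_wpM2l// !indicE ler_nat.
by case: (boolP (j \in A)) => // /set_mem/AB/mem_set ->.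
Qed.

(** The weights have to be chosen before the open set: a countable pi-base
    reduces this to choosing them for countably many return sets. *)
Lemma RHC_bigcup (B : nat -> set X) (T : X -> X) :
    (forall i, open (B i) /\ B i !=set0) ->
    (forall U, open U -> U !=set0 -> exists i, B i `<=` U) ->
  RHC R T = \bigcup_(a in @classS R) UFHC_wrt a T.
Proof.
move=> oB sB; apply/seteqP; split=> [x Tx|x [a Sa Tx] U oU U0]; last first.
  by apply: weighted_gt0_upper_banach Sa _; exact: Tx.
have [a Sa aB] := exists_classS_weighted_gt0
  (fun i => Tx (B i) (oB i).1 (oB i).2).
exists a => // U oU U0; have [i BU] := sB U oU U0.
have [a0 _ _ _ _] := Sa.
apply: weighted_gt0_subset a0 _ (aB i) => n; exact: BU.
Qed.

End Orbits.

Theorem theorem1p8 (R : realType) (K : numFieldType)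
    (hK : real_or_complex R K) (X : completeNormedModType K)
    (hsep : separable X) (hdim : infinite_dimensional X)
    (T : {linear X -> X}) (hT : bounded_operator T) :
  [/\ U_frequently_hypercyclic R T <->
        (forall a : R^nat, classS a -> U_frequently_hypercyclic_wrt a T),
      reiteratively_hypercyclic R T <->
        (exists2 a : R^nat, classS a & U_frequently_hypercyclic_wrt a T),
      UFHC R T = \bigcap_(a in @classS R) UFHC_wrt a T
    & RHC R T = \bigcup_(a in @classS R) UFHC_wrt a T].
Proof.
have [B [oB sB]] := countable_pi_base hK hsep.
have capE := @UFHC_bigcap R X T; have cupE := @RHC_bigcup R X B T oB sB.
split => //; split.
- by move=> [x]; rewrite capE => Tx a Sa; exists x; exact: Tx.
- move=> /(_ _ classS_succ)[x Tx]; exists x => U oU U0.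
  by apply: weighted_succ_gt0_upper_density; exact: Tx.
- by move=> [x]; rewrite cupE => -[a Sa Tx]; exists a => //; exists x.
- by move=> [a Sa [x Tx]]; exists x; rewrite cupE; exists a.
Qed.
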